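(* Consider a multinomial logit model with non-proportional odds (npo) as described in the context. Suppose $p_1=\cdots=p_{J-1}$ and there exist $p_1$ distinct experimental settings such that ${\rm rank}(\mathbf H_1)=\cdots={\rm rank}(\mathbf H_{J-1})=p_1$. Then the minimal number of experimental settings (i.e. the smallest number of distinct experimental settings for which some allocation yields a positive definite Fisher information matrix) is $m=p_1$, and the uniform allocation $(1/m,\dots,1/m)^T$ is D-optimal among minimally supported designs.
   Context: npo model. $J\ge2$ response categories; known functions $\mathbf h_j$ with values in $\mathbb R^{p_j}$, parameters $\boldsymbol\beta_j\in\mathbb R^{p_j}$ ($j=1,\dots,J-1$), $\boldsymbol\theta=(\boldsymbol\beta_1^T,\dots,\boldsymbol\beta_{J-1}^T)^T\in\mathbb R^p$, $p=p_1+\dots+p_{J-1}$. At an experimental setting $\mathbf x_i\in\mathbb R^d$ the category probabilities $\boldsymbol\pi_i=(\pi_{i1},\dots,\pi_{iJ})^T$ (summing to one, all assumed strictly positive) satisfy, for one fixed choice among four logit types, $\log(\nu_{ij}/\delta_{ij})=\mathbf h_j^T(\mathbf x_i)\boldsymbol\beta_j$, $j=1,\dots,J-1$, where $(\nu_{ij},\delta_{ij})$ is: $(\pi_{ij},\pi_{iJ})$ (baseline-category); $(\pi_{i1}+\dots+\pi_{ij},\ \pi_{i,j+1}+\dots+\pi_{iJ})$ (cumulative); $(\pi_{ij},\pi_{i,j+1})$ (adjacent-categories); $(\pi_{ij},\ \pi_{i,j+1}+\dots+\pi_{iJ})$ (continuation-ratio). The parameter value $\boldsymbol\theta$ is fixed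 (local optimality). For distinct settings $\mathbf x_1,\dots,\mathbf x_m$: $\mathbf H_j=(\mathbf h_j(\mathbf x_1),\dots,\mathbf h_j(\mathbf x_m))$ ($p_j\times m$). With $n_i$ independent observations at $\mathbf x_i$, $n=\sum_i n_i$, $w_i=n_i/n$, the Fisher information matrix of $\boldsymbol\theta$ is $\mathbf F=n\sum_{i=1}^m w_i\mathbf F_i$ with $\mathbf F_i=(\partial\boldsymbol\pi_i/\partial\boldsymbol\theta^T)^T{\rm diag}(\boldsymbol\pi_i)^{-1}(\partial\boldsymbol\pi_i/\partial\boldsymbol\theta^T)$. An (approximate) allocation is $\mathbf w=(w_1,\dots,w_m)^T$ with $w_i\ge0$, $\sum_i w_i=1$; its objective function is $f(\mathbf w)=|\sum_i w_i\mathbf F_i|$ (determinant). A minimally supported design is a design with $f>0$ using the minimal number $m$ of distinct experimental settings. ''The uniform allocation is D-optimal among minimally supported designs'' means: for any minimal set of $m$ distinct settings supporting a design with $f>0$, the uniform allocation on those $m$ settings maximizes $f(\mathbf w)$ over all allocations $\mathbf w$ on them. *)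

(* Defs.v *)
From HB Require Import structures.
From mathcomp Require Import all_boot all_order all_algebra.
From mathcomp Require Import all_classical all_reals all_analysis.

Set Implicit Arguments.
Unset Strict Implicit.
Unset Printing Implicit Defensive.

Import Order.TTheory GRing.Theory Num.Theory.
Import numFieldNormedType.Exports.
Local Open Scope classical_set_scope.
Local Open Scope ring_scope.

(* There are K.+1 = J response categories, hence K = J - 1 logits; categories
   and logits are numbered from 0.  Vectors of category probabilities and of
   parameters are row vectors: theta is the concatenation of the rows
   beta_j^T, so submxrow theta j = beta_j^T. *)

Inductive logit_type := Baseline | Cumulative | Adjacent | Continuation.

Section Model.
Variables (R : realType) (K d : nat) (p : 'I_K -> nat).

Definition category (j : 'I_K) : 'I_K.+1 := widen_ord (leqnSn K) j.

Definition next_category (j : 'I_K) : 'I_K.+1 := lift ord0 j.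

Definition logit_num (L : logit_type) (pi : 'rV[R]_K.+1) (j : 'I_K) : R :=
  match L with
  | Baseline | Adjacent | Continuation => pi 0 (category j)
  | Cumulative => \sum_(k < K.+1 | (k <= j)%N) pi 0 k
  end.

Definition logit_den (L : logit_type) (pi : 'rV[R]_K.+1) (j : 'I_K) : R :=
  match L with
  | Baseline => pi 0 ord_max
  | Adjacent => pi 0 (next_category j)
  | Cumulative | Continuation => \sum_(k < K.+1 | (j < k)%N) pi 0 k
  end.

Definition params := 'rV[R]_(\sum_(j < K) p j).

Definition positive_prob (pi : 'rV[R]_K.+1) : Prop :=
  (forall k, 0 < pi 0 k) /\ \sum_k pi 0 k = 1.

Definition npo_model (L : logit_type) (h : forall j, 'rV[R]_d -> 'cV[R]_(p j))
    (x : 'rV[R]_d) (theta : params) (pi : 'rV[R]_K.+1) : Prop :=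
  positive_prob pi /\
  forall j, ln (logit_num L pi j / logit_den L pi j)
            = ((h j x)^T *m (submxrow theta j)^T) 0 0.

(* The logit equations have at most one positive solution, so the choice made
   by xget is immaterial.  For cumulative logits some theta admit no solution,
   but the set of theta that do is open, so the default value 0 does not
   interfere with derivatives at a feasible theta. *)
Definition npo_prob (L : logit_type) (h : forall j, 'rV[R]_d -> 'cV[R]_(p j))
    (x : 'rV[R]_d) (theta : params) : 'rV[R]_K.+1 :=
  xget 0 [set pi | npo_model L h x theta pi].

(* With the row-vector convention, 'J f theta = (d f / d theta^T)^T. *)
Definition fisher_at (L : logit_type) (h : forall j, 'rV[R]_d -> 'cV[R]_(p j))
    (theta : params) (x : 'rV[R]_d) : 'M[R]_(\sum_(j < K) p j) :=
  let D := 'J (npo_prob L h x) theta in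
  D *m invmx (diag_mx (npo_prob L h x theta)) *m D^T.

Definition fisher_mix (L : logit_type) (h : forall j, 'rV[R]_d -> 'cV[R]_(p j))
    (theta : params) (m : nat) (x : 'I_m -> 'rV[R]_d) (w : 'I_m -> R) :
    'M[R]_(\sum_(j < K) p j) :=
  \sum_(i < m) w i *: fisher_at L h theta (x i).

Definition fisher_information (n : nat) (L : logit_type)
    (h : forall j, 'rV[R]_d -> 'cV[R]_(p j)) (theta : params)
    (m : nat) (x : 'I_m -> 'rV[R]_d) (w : 'I_m -> R) :
    'M[R]_(\sum_(j < K) p j) :=
  n%:R *: fisher_mix L h theta x w.

Definition objective (L : logit_type) (h : forall j, 'rV[R]_d -> 'cV[R]_(p j))
    (theta : params) (m : nat) (x : 'I_m -> 'rV[R]_d) (w : 'I_m -> R) : R :=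
  \det (fisher_mix L h theta x w).

Definition design_mx (h : forall j, 'rV[R]_d -> 'cV[R]_(p j))
    (m : nat) (x : 'I_m -> 'rV[R]_d) (j : 'I_K) : 'M[R]_(p j, m) :=
  \matrix_(a < p j, i < m) h j (x i) a 0.

Definition distinct_settings (X : set 'rV[R]_d) (m : nat)
    (x : 'I_m -> 'rV[R]_d) : Prop :=
  injective x /\ forall i, X (x i).

Definition allocation (m : nat) (w : 'I_m -> R) : Prop :=
  (forall i, 0 <= w i) /\ \sum_i w i = 1.

Definition uniform_allocation (m : nat) : 'I_m -> R := fun=> m%:R^-1.

Definition posdefmx (q : nat) (A : 'M[R]_q) : Prop :=
  A^T = A /\ forall v : 'rV[R]_q, v != 0 -> 0 < (v *m A *m v^T) 0 0.

Definition supports_posdef (X : set 'rV[R]_d) (n : nat) (L : logit_type)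
    (h : forall j, 'rV[R]_d -> 'cV[R]_(p j)) (theta : params) (m : nat) : Prop :=
  exists x : 'I_m -> 'rV[R]_d, distinct_settings X x /\
  exists w, allocation w /\ posdefmx (fisher_information n L h theta x w).

Definition minimal_number (X : set 'rV[R]_d) (n : nat) (L : logit_type)
    (h : forall j, 'rV[R]_d -> 'cV[R]_(p j)) (theta : params) (m : nat) : Prop :=
  supports_posdef X n L h theta m /\
  forall m', supports_posdef X n L h theta m' -> (m <= m')%N.

Definition D_optimal (L : logit_type) (h : forall j, 'rV[R]_d -> 'cV[R]_(p j))
    (theta : params) (m : nat) (x : 'I_m -> 'rV[R]_d) (w : 'I_m -> R) : Prop :=
  allocation w /\
  forall w', allocation w' -> objective L h theta x w' <= objective L h theta x w.

End Model.

Arguments uniform_allocation {R} m.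

(* Main.v *)
(* For each logit type the equations nu_j = exp(eta_j) delta_j together with
   the normalisation form a linear system pi A(eta) = e, and A(eta) is
   invertible for every eta.  Hence near theta the probabilities at x equal
   e A(theta H)^-1 with H = diag(h_1(x), .., h_(J-1)(x)), and differentiating
   pi A = e gives their Jacobian H [0 | diag(nu)] A^-1.  So F_x = H U H^T with
   U positive definite of order K = J - 1.  With m settings the information
   matrix has rank at most m K while theta has K p1 components, so m >= p1; at
   p1 settings with all H_j of full rank, v F v^T = 0 forces v H = 0 at every
   setting, hence v = 0.  For m = p1 the information matrix factors through
   square matrices, so its determinant is c (w_1 .. w_m)^K and AM-GM shows
   that equal weights maximise it. *)
Require Import Defs.
From HB Require Import structures.
From mathcomp Require Import all_boot all_order all_algebra.
From mathcomp Require Import all_classical all_reals all_analysis.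

Set Implicit Arguments.
Unset Strict Implicit.
Unset Printing Implicit Defensive.

Import Order.TTheory GRing.Theory Num.Theory.
Import numFieldNormedType.Exports.
Local Open Scope classical_set_scope.
Local Open Scope ring_scope.

(** * Determinant and rank of weighted sums of matrix products *)

Lemma det_mxdiag_scalar (F : comNzRingType) (m k : nat) (w : 'I_m -> F) :
  \det (\mxdiag_(i < m) ((w i)%:M : 'M[F]_k)) = (\prod_i w i) ^+ k.
Proof.
have -> : \mxdiag_(i < m) ((w i)%:M : 'M[F]_k) =
    diag_mx (\mxrow_(i < m) (const_mx (w i) : 'rV[F]_k)).
  by rewrite diag_mxrow; apply: eq_mxdiag => i; rewrite diag_const_mx.
rewrite det_diag.
under eq_bigr do rewrite !mxE.
rewrite -prodrXl.
under [RHS]eq_bigr do rewrite -[k in _ ^+ k]card_ord -prodr_const.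
(* Each weight is repeated [k] times on the diagonal; [tagnat.sig] matches flat diagonal indices
   with pairs (block, position in block). *)
rewrite [RHS]sig_big_dep/= (reindex _ tagnat.sig_bij_on)/=.
by apply: eq_bigl.
Qed.

(** The sum is a block row times a block diagonal matrix of scalar blocks times a block column. The
    size condition makes the outer factors square, so their determinants form [c] and the weights
    enter only through the middle factor. *)
Lemma det_sum_scale_mulmx (F : comNzRingType) (q m k : nat)
    (B : 'I_m -> 'M[F]_(q, k)) (C : 'I_m -> 'M[F]_(k, q)) : q = (m * k)%N ->
  exists c, forall w : 'I_m -> F,
    \det (\sum_i w i *: (B i *m C i)) = c * (\prod_i w i) ^+ k.
Proof.
have -> : (m * k)%N = (\sum_(i < m) k)%N by rewrite sum_nat_const card_ord.
move=> e; subst q; exists (\det (\mxrow_i B i) * \det (\mxcol_i C i)) => w.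
have -> : \sum_i w i *: (B i *m C i) =
    \mxrow_i B i *m (\mxdiag_i (w i)%:M *m \mxcol_i C i).
  rewrite mul_mxdiag_mxcol mul_mxrow_mxcol; apply: eq_bigr => i _.
  by rewrite mul_scalar_mx scalemxAr.
by rewrite !det_mulmx det_mxdiag_scalar mulrAC mulrA.
Qed.

(** The sum factors through a space of dimension [m * k]; no relation between [q] and [m * k] is
    required. *)
Lemma mxrank_sum_scale_mulmx (F : fieldType) (q m k : nat)
    (B : 'I_m -> 'M[F]_(q, k)) (C : 'I_m -> 'M[F]_(k, q)) (w : 'I_m -> F) :
  (\rank (\sum_i w i *: (B i *m C i))%R <= m * k)%N.
Proof.
have -> : \sum_i w i *: (B i *m C i) = \mxrow_i B i *m \mxcol_i (w i *: C i).
  by rewrite mul_mxrow_mxcol; apply: eq_bigr => i _; rewrite scalemxAr.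
have -> : (m * k)%N = (\sum_(i < m) k)%N by rewrite sum_nat_const card_ord.
exact: leq_trans (mxrankM_maxl _ _) (rank_leq_col _).
Qed.

(** * Positive definite matrices *)

Section PositiveDefinite.
Variable R : realType.

Lemma posdefmx_rank (q : nat) (A : 'M[R]_q) : posdefmx A -> \rank A = q.
Proof.
move=> [_ Apos]; apply/eqP/inj_row_free => v vA0; apply/eqP.
by apply: contraT => /Apos; rewrite vA0 mul0mx mxE ltxx.
Qed.

Lemma posdefmx_diag (q : nat) (a : 'rV[R]_q) :
  (forall k, 0 < a 0 k) -> posdefmx (diag_mx a).
Proof.
move=> a0; split=> [|v v0]; first exact: tr_diag_mx.
have vavE : (v *m diag_mx a *m v^T) 0 0 = \sum_k v 0 k ^+ 2 * a 0 k.
  rewrite mxE; apply: eq_bigr => k _.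
  by rewrite mul_mx_diag !mxE mulrAC.
have t0 k : 0 <= v 0 k ^+ 2 * a 0 k by rewrite mulr_ge0 ?sqr_ge0 ?ltW.
rewrite vavE lt_def sumr_ge0 // andbT.
apply: contraNneq v0 => /(psumr_eq0P (fun k _ => t0 k)) h0.
apply/eqP/rowP => k; rewrite mxE; apply/eqP.
by have /eqP := h0 k isT; rewrite mulf_eq0 sqrf_eq0 (gt_eqF (a0 k)) orbF.
Qed.

Lemma invmx_diag (q : nat) (a : 'rV[R]_q) : (forall k, 0 < a 0 k) ->
  invmx (diag_mx a) = diag_mx (map_mx GRing.inv a).
Proof.
move=> a0; have ab1 : diag_mx a *m diag_mx (map_mx GRing.inv a) = 1%:M.
  rewrite mulmx_diag -diag_const_mx; congr diag_mx.
  by apply/rowP => k; rewrite !mxE divff // gt_eqF.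
have [aU _] := mulmx1_unit ab1.
by rewrite -[RHS]mul1mx -(mulVmx aU) -mulmxA ab1 mulmx1.
Qed.

Lemma posdefmx_congr (q r : nat) (M : 'M[R]_(q, r)) (A : 'M[R]_r) :
  row_free M -> posdefmx A -> posdefmx (M *m A *m M^T).
Proof.
move=> Mfree [AT Apos]; split=> [|v v0].
  by rewrite !trmx_mul trmxK AT mulmxA.
have := Apos (v *m M); rewrite mulmx_free_eq0 // => /(_ v0).
by rewrite trmx_mul !mulmxA.
Qed.

End PositiveDefinite.

(** * Allocations and the AM-GM inequality *)

Lemma uniform_allocationP (R : realType) (m : nat) : (0 < m)%N ->
  allocation (uniform_allocation m : 'I_m -> R).
Proof.
move=> m0; split=> [i|]; first by rewrite invr_ge0 ler0n.
by rewrite sumr_const card_ord -[LHS]mulr_natr mulVf // pnatr_eq0 -lt0n.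
Qed.

Lemma prod_allocation_le (R : realType) (m : nat) (w : 'I_m -> R) :
  allocation w -> \prod_i w i <= \prod_i uniform_allocation m i.
Proof.
move=> [w0 w1].
have [+ _] := @leif_AGM _ 'I_m predT w (in1W w0).
by rewrite w1 div1r cardT size_enum_ord prodr_const card_ord.
Qed.

(** * The linear system satisfied by the category probabilities *)

Section LogitSystem.
Variables (R : realType) (K : nat).
Implicit Types (L : logit_type) (u : 'rV[R]_K.+1) (eta : 'rV[R]_K).

Lemma categoryE (j : 'I_K) : category j = lift ord_max j.
Proof. exact/val_inj/esym/lift_max. Qed.

Lemma tail_sum_eq0 u : (forall k, (k <= K)%N ->
    \sum_(i < K.+1 | (k <= i)%N) u 0 i = 0) -> u = 0.
Proof.
move=> t0; apply/rowP => k; rewrite [RHS]mxE.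
have kK : (k <= K)%N by rewrite -ltnS.
have := t0 k kK; rewrite (bigD1 k) //=.
rewrite (eq_bigl (fun i : 'I_K.+1 => (k < i)%N)); last first.
  by move=> i; rewrite [RHS]ltn_neqAle andbC eq_sym.
have [kltK|Kk] := ltnP k K; first by rewrite t0 // addr0.
rewrite big_pred0 ?addr0 // => i.
by apply/negbTE; rewrite -leqNgt (leq_trans _ Kk) // -ltnS.
Qed.

(** Triviality of the kernel of the logit system, with [rho] standing for the exponentials. Baseline
    and adjacent logits make every entry a nonnegative multiple of the last one; cumulative and
    continuation logits make all tail sums vanish. *)
Lemma logit_system_inj L (rho : 'I_K -> R) u : (forall j, 0 < rho j) ->
  \sum_k u 0 k = 0 ->
  (forall j, logit_num L u j = rho j * logit_den L u j) -> u = 0.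
Proof.
move=> rho0 su0 uE.
have rho1 j : 1 + rho j != 0 by rewrite gt_eqF // addr_gt0.
have multiples_of_last :
    (forall k, exists2 c, 0 <= c & u 0 k = c * u 0 ord_max) -> u = 0.
  move=> uE'.
  (* The products [u 0 k * u 0 ord_max] are nonnegative and sum to zero, so each vanishes, in
     particular the square of the last entry. *)
  have ge0 k : 0 <= u 0 k * u 0 ord_max.
    by have [c c0 ->] := uE' k; rewrite -mulrA mulr_ge0 // -expr2 sqr_ge0.
  have um0 : u 0 ord_max = 0.
    have : \sum_k u 0 k * u 0 ord_max = 0 by rewrite -mulr_suml su0 mul0r.
    move/(psumr_eq0P (fun k _ => ge0 k))/(_ ord_max isT)/eqP.
    by rewrite mulf_eq0 orbb => /eqP.
  by apply/rowP => k; have [c _ ->] := uE' k; rewrite um0 mulr0 mxE.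
case: L uE => /= uE.
- apply: multiples_of_last => k; have [j ->|->] := unliftP ord_max k.
    exists (rho j); first exact: ltW.
    by rewrite -uE categoryE.
  by exists 1; rewrite ?mul1r.
(* The tail from 0 is the total. For a later tail T, the total is rho T + T, and 1 + rho is
   nonzero. *)
- apply: tail_sum_eq0 => -[_|j jK] //=.
  have /eqP := su0; rewrite (bigID (fun k : 'I__ => (k <= j)%N)) /=.
  rewrite (uE (Ordinal jK)) /=.
  rewrite [X in _ + X](eq_bigl (fun k : 'I_K.+1 => (j < k)%N)); last first.
    by move=> k; rewrite ltnNge.
  by rewrite -{2}[\sum_(_ | _) _]mul1r addrC -mulrDl mulf_eq0
    (negbTE (rho1 _)) => /eqP.
- apply: multiples_of_last => k.
  (* Downward induction from the last category, multiplying the odds along the way. *)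
  have [i] := ubnP (K - k)%N; elim: i k => // i IH k.
  have [j ->|-> _] := unliftP ord_max k; last by exists 1; rewrite ?mul1r.
  rewrite -categoryE => ki.
  have [|c c0 ucE] := IH (next_category j).
    by move: ki; rewrite lift0 /= -(subnSK (ltn_ord j)) ltnS.
  exists (rho j * c); first by rewrite mulr_ge0 // ltW.
  by rewrite uE ucE mulrA.
(* The tail from [k] is 1 + rho times the tail from [k.+1], so vanishing propagates upwards from the
   total. *)
- apply: tail_sum_eq0; elim=> [_|k IH kK] //=.
  have /eqP := IH (ltnW kK); rewrite (bigD1 (category (Ordinal kK))) //=.
  rewrite (eq_bigl (fun i : 'I_K.+1 => (k < i)%N)); last first.
    by move=> i; rewrite [RHS]ltn_neqAle andbC -(inj_eq val_inj) eq_sym.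
  by rewrite uE /= -{2}[\sum_(_ | _) _]mul1r addrC -mulrDl mulf_eq0
    (negbTE (rho1 _)) => /eqP.
Qed.

(* Cumulative is qualified: all_analysis exports the same name. *)
Definition num_mx L : 'M[R]_(K.+1, K) :=
  \matrix_(k, j) (match L with
                  | Defs.Cumulative => (k <= j)%N
                  | _ => k == category j
                  end)%:R.

Definition den_mx L : 'M[R]_(K.+1, K) :=
  \matrix_(k, j) (match L with
                  | Baseline => k == ord_max
                  | Adjacent => k == next_category j
                  | _ => (j < k)%N
                  end)%:R.

Lemma sum_mul_indic u (P : pred 'I_K.+1) :
  \sum_k u 0 k * (P k)%:R = \sum_(k | P k) u 0 k.
Proof.
rewrite [RHS]big_mkcond; apply: eq_bigr => k _.
by case: (P k); rewrite ?mulr1 ?mulr0.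
Qed.

Lemma mul_num_mx L u j : (u *m num_mx L) 0 j = logit_num L u j.
Proof.
rewrite mxE; under eq_bigr do rewrite mxE.
by case: L => /=; rewrite sum_mul_indic ?big_pred1_eq.
Qed.

Lemma mul_den_mx L u j : (u *m den_mx L) 0 j = logit_den L u j.
Proof.
rewrite mxE; under eq_bigr do rewrite mxE.
by case: L => /=; rewrite sum_mul_indic ?big_pred1_eq.
Qed.

(* The logit equations nu_j = exp(eta_j) delta_j are linear in the category
   probabilities; the first column is the normalisation. *)
Definition logit_mx L eta : 'M[R]_K.+1 :=
  row_mx (const_mx 1 : 'M[R]_(K.+1, 1))
    (num_mx L - den_mx L *m diag_mx (map_mx expR eta)).

Definition rhs_vec : 'rV[R]_K.+1 :=
  row_mx (const_mx 1 : 'M[R]_1) (0 : 'rV[R]_K).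

Lemma mul_logit_mx L eta u : u *m logit_mx L eta =
  row_mx (const_mx (\sum_k u 0 k) : 'M[R]_1)
    (\row_j (logit_num L u j - logit_den L u j * expR (eta 0 j))).
Proof.
(* Explicit dimensions make the column count [K.+1] be read as [1 + K]. *)
apply: (etrans (@mul_mx_row _ 1 K.+1 1 K u _ _)); congr row_mx.
  apply/matrixP => i j; rewrite !ord1 !mxE.
  by apply: eq_bigr => k _; rewrite mxE mulr1.
rewrite mulmxBr mulmxA mul_mx_diag; apply/rowP => j; rewrite !mxE.
by rewrite -mul_num_mx -mul_den_mx !mxE.
Qed.

Lemma logit_mx_unit L eta : logit_mx L eta \in unitmx.
Proof.
rewrite -row_free_unit; apply: inj_row_free => u.
rewrite mul_logit_mx -[RHS](@row_mx0 _ 1 1 K) =>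
  /(@eq_row_mx R 1 1 K)[/rowP su /rowP uE].
apply: (@logit_system_inj L (fun j => expR (eta 0 j))) => [j||j].
- exact: expR_gt0.
- by have := su 0; rewrite !mxE.
- by have /eqP := uE j; rewrite !mxE subr_eq0 mulrC => /eqP.
Qed.

(** Defined for every [eta], even where the solution has nonpositive entries, as can happen for
    cumulative logits. This gives a globally differentiable function to compare with [npo_prob]. *)
Definition logit_sol L eta : 'rV[R]_K.+1 := rhs_vec *m invmx (logit_mx L eta).

Lemma logit_solP L eta u : u = logit_sol L eta <->
  \sum_k u 0 k = 1 /\
  forall j, logit_num L u j = logit_den L u j * expR (eta 0 j).
Proof.
have -> : u = logit_sol L eta <-> u *m logit_mx L eta = rhs_vec.
  rewrite /logit_sol; split=> [->|<-].
    by rewrite mulmxKV // logit_mx_unit.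
  by rewrite mulmxK // logit_mx_unit.
rewrite mul_logit_mx /rhs_vec.
split=> [/(@eq_row_mx R 1 1 K)[/rowP su /rowP uE]|[-> uE]].
  split=> [|j]; first by have := su 0; rewrite !mxE.
  by have /eqP := uE j; rewrite !mxE subr_eq0 => /eqP.
apply: (congr1 (@row_mx R 1 1 K _)).
by apply/rowP => j; rewrite !mxE uE subrr.
Qed.

Lemma logit_num_gt0 L u j : (forall k, 0 < u 0 k) -> 0 < logit_num L u j.
Proof.
move=> u0; case: L => //=; rewrite (bigD1 (category j)) //=.
by rewrite ltr_pwDl // sumr_ge0 // => k _; rewrite ltW.
Qed.

Lemma logit_den_gt0 L u j : (forall k, 0 < u 0 k) -> 0 < logit_den L u j.
Proof.
move=> u0; case: L => //=; rewrite (bigD1 ord_max) //=;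
  by rewrite ltr_pwDl // sumr_ge0 // => k _; rewrite ltW.
Qed.

End LogitSystem.

(** * From the parameter to the linear predictors and the probabilities *)

Section LinearPredictor.
Variables (R : realType) (K d : nat) (p : 'I_K -> nat).
Implicit Types (h : forall j, 'rV[R]_d -> 'cV[R]_(p j)).

(** The block diagonal matrix diag(h_1(x), .., h_(J-1)(x)): [delta_mx 0 j] puts block [j] in column
    [j]. *)
Definition predictor_mx h x : 'M[R]_(\sum_(j < K) p j, K) :=
  \mxcol_j (h j x *m delta_mx 0 j).

Lemma mul_predictor_mx h x (v : params R p) j :
  (v *m predictor_mx h x) 0 j = ((h j x)^T *m (submxrow v j)^T) 0 0.
Proof.
rewrite -[v in LHS]submxrowK mul_mxrow_mxcol summxE (bigD1 j) //=.
rewrite big1 ?addr0 => [|i ij]; rewrite mulmxA mxE big_ord1 [X in _ * X]mxE.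
  by rewrite !eqxx mulr1 -trmx_mul [RHS]mxE.
by rewrite [_ == i]eq_sym (negbTE ij) andbF mulr0.
Qed.

(** For positive probabilities numerator and denominator are positive, so [ln] and [expR] translate
    the logit equations into the linear system and back. *)
Lemma npo_modelP L h x (v : params R p) pi : npo_model L h x v pi <->
  (forall k, 0 < pi 0 k) /\ pi = logit_sol L (v *m predictor_mx h x).
Proof.
rewrite logit_solP; split=> [[[pi0 pi1] piE]|[pi0 [pi1 piE]]].
  split=> //; split=> // j; rewrite mul_predictor_mx -piE lnK.
    by rewrite mulrC divfK // gt_eqF // logit_den_gt0.
  by rewrite posrE divr_gt0 ?logit_num_gt0 ?logit_den_gt0.
split=> [|j]; first by split.
rewrite -mul_predictor_mx piE mulrAC divff ?mul1r.
  by rewrite expRK.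
by rewrite gt_eqF // logit_den_gt0.
Qed.

Lemma npo_probE L h x (v : params R p) :
  (forall k, 0 < logit_sol L (v *m predictor_mx h x) 0 k) ->
  npo_prob L h x v = logit_sol L (v *m predictor_mx h x).
Proof.
move=> pi0; have /npo_modelP[] : npo_model L h x v (npo_prob L h x v).
  apply: xgetPex; exists (logit_sol L (v *m predictor_mx h x)).
  exact/npo_modelP.
by [].
Qed.

End LinearPredictor.

(** * Differential calculus for matrix-valued functions *)

Section MatrixCalculus.
Variables (R : realType) (V : normedModType R).

Lemma differentiable_bigsum (I : Type) (r : seq I) (P : pred I)
    (f : I -> V -> R) a : (forall i, P i -> differentiable (f i) a) ->
  differentiable (fun x => \sum_(i <- r | P i) f i x) a.
Proof.
move=> df; rewrite -fct_sumE.
by elim/big_ind : _ => // g1 g2 ? ?; exact: differentiableD.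
Qed.

Lemma differentiable_bigprod (I : Type) (r : seq I) (P : pred I)
    (f : I -> V -> R) a : (forall i, P i -> differentiable (f i) a) ->
  differentiable (fun x => \prod_(i <- r | P i) f i x) a.
Proof.
move=> df; rewrite -fct_prodE.
by elim/big_ind : _ => // g1 g2 ? ?; exact: differentiableM.
Qed.

Lemma differentiable_mx (m n : nat) (M : V -> 'M[R]_(m, n)) a :
  (forall i j, differentiable (fun x => M x i j) a) -> differentiable M a.
Proof.
move=> dM.
have -> : M = \sum_i \sum_j (fun x => M x i j *: delta_mx i j).
  apply/funext => x; rewrite fct_sumE [LHS]matrix_sum_delta.
  by apply: eq_bigr => i _; rewrite fct_sumE.
apply: differentiable_sum => i; apply: differentiable_sum => j.
exact: differentiableZl.
Qed.

Lemma differentiable_det (n : nat) (M : V -> 'M[R]_n) a :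
  (forall i j, differentiable (fun x => M x i j) a) ->
  differentiable (fun x => \det (M x)) a.
Proof.
move=> dM; apply: differentiable_bigsum => s _.
apply: (@differentiableM _ _ (cst _)); first exact: differentiable_cst.
exact: differentiable_bigprod.
Qed.

(** By the cofactor formula. Invertibility at every point, not only at [a], makes that formula an
    equality of functions. *)
Lemma differentiable_invmx (n : nat) (M : V -> 'M[R]_n) a :
  (forall x, M x \in unitmx) ->
  (forall i j, differentiable (fun x => M x i j) a) ->
  forall i j, differentiable (fun x => invmx (M x) i j) a.
Proof.
move=> Mu dM i j.
have -> : (fun x => invmx (M x) i j) =
    (fun x => (\det (M x))^-1) * (fun x => cofactor (M x) j i).
  by apply/funext => x; rewrite /invmx Mu !mxE.
apply: differentiableM.
  apply: differentiableV; first exact: differentiable_det.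
  by have := Mu a; rewrite unitmxE unitfE.
apply: (@differentiableM _ _ (cst _)); first exact: differentiable_cst.
apply: differentiable_det => k l.
by under eq_fun do rewrite !mxE; exact: dM.
Qed.

Lemma near_eq_differentiable (W : normedModType R) (f g : V -> W) a :
  (\near a, f a = g a) -> differentiable f a -> differentiable g a.
Proof.
move=> fg df.
(* The first-order expansion of [f] at [a] is also one of [g], as it only involves values near
   [a]. *)
have dg : g \o shift a = cst (g a) + 'd f a +o_ 0 id.
  apply/eqaddoP => e e0.
  have /eqaddoP/(_ e e0) := diff_locally df.
  have := fg; rewrite (near_shift 0) subr0.
  apply: filterS2 => x /= fgx; rewrite /= !fctE /= fgx.
  by rewrite (nbhs_singleton fg).
have dE := diff_unique (diff_continuous df) dg.
by apply/diff_locallyP; rewrite dE; split => //; exact: diff_continuous.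
Qed.

Lemma derive_mulmx (m n q : nat) (M : V -> 'M[R]_(m, n)) (N : V -> 'M[R]_(n, q))
    a v : derivable M a v -> derivable N a v ->
  'D_v (fun x => M x *m N x) a = 'D_v M a *m N a + M a *m 'D_v N a.
Proof.
move=> dM dN; have /derivable_mxP dM' := dM; have /derivable_mxP dN' := dN.
have E i j : (fun x => (M x *m N x) i j) =
    \sum_k (fun x => M x i k) * (fun x => N x k j).
  by apply/funext => x; rewrite fct_sumE mxE.
have dMN k i j : derivable ((fun x => M x i k) * (fun x => N x k j)) a v.
  exact: derivableM.
rewrite derive_mx; last first.
  by apply/derivable_mxP => i j; rewrite E; exact: derivable_sum.
apply/matrixP => i j; rewrite !derive_mx // !mxE E derive_sum //.
rewrite -[RHS]big_split /=; apply: eq_bigr => k _.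
rewrite deriveM // !mxE [RHS]addrC; congr (_ + _); exact: mulrC.
Qed.

End MatrixCalculus.

(** * Derivative of the solution of the logit system in the parameter *)

Lemma differentiable_mulmx_coord (R : realType) (q K : nat)
    (H : 'M[R]_(q, K)) j (a : 'rV[R]_q) :
  differentiable (fun v : 'rV[R]_q => (v *m H) 0 j) a.
Proof.
under eq_fun do rewrite mxE.
apply: differentiable_bigsum => i _.
apply: (@differentiableM _ _ _ (cst _)); last exact: differentiable_cst.
exact: differentiable_coord.
Qed.

Lemma derive_mulmx_coord (R : realType) (q K : nat) (H : 'M[R]_(q, K)) j
    (a v : 'rV[R]_q) :
  'D_v (fun u : 'rV[R]_q => (u *m H) 0 j) a = (v *m H) 0 j.
Proof.
rewrite deriveE; last exact: differentiable_mulmx_coord.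
have lin_f : linear (fun u : 'rV[R]_q => (u *m H) 0 j).
  by move=> c u1 u2; rewrite mulmxDl -scalemxAl !mxE.
(* Packed as a linear map, the coordinate is its own differential. *)
pose f : {linear 'rV[R]_q -> R} := HB.pack (fun u : 'rV[R]_q => (u *m H) 0 j)
  (GRing.isLinear.Build _ _ _ _ _ lin_f).
rewrite -[fun u => _]/(f : _ -> _) diff_lin // => x.
exact/differentiable_continuous/differentiable_mulmx_coord.
Qed.

Lemma differentiable_expR (R : realType) (x : R) : differentiable expR x.
Proof. exact/derivable1_diffP/derivable_expR. Qed.

Section LogitDerivative.
Variables (R : realType) (K q : nat) (L : logit_type) (H : 'M[R]_(q, K)).

Lemma logit_mxE (eta : 'rV[R]_K) i j : logit_mx L eta i j =
  match fintype.split (j : 'I_(1 + K)) with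
  | inl _ => 1
  | inr k => num_mx R K L i k - den_mx R K L i k * expR (eta 0 k)
  end.
Proof.
rewrite /logit_mx mul_mx_diag mxE.
by case: (fintype.split _) => k; rewrite !mxE.
Qed.

Lemma differentiable_exp_predictor k a :
  differentiable (fun v : 'rV[R]_q => expR ((v *m H) 0 k)) a.
Proof.
apply: differentiable_comp (differentiable_expR _).
exact: differentiable_mulmx_coord.
Qed.

Lemma differentiable_logit_mx a i j :
  differentiable (fun v : 'rV[R]_q => logit_mx L (v *m H) i j) a.
Proof.
under eq_fun do rewrite logit_mxE.
case: (fintype.split _) => k; first exact: differentiable_cst.
apply: differentiableB; first exact: differentiable_cst.
apply: (@differentiableM _ _ (cst _)); first exact: differentiable_cst.
exact: differentiable_exp_predictor.
Qed.

Lemma derivable_logit_mx (a v : 'rV[R]_q) :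
  derivable (fun t : 'rV[R]_q => logit_mx L (t *m H)) a v.
Proof.
apply/derivable_mxP => i j.
exact/diff_derivable/differentiable_logit_mx.
Qed.

Lemma derive_exp_predictor k (a v : 'rV[R]_q) :
  'D_v (fun t : 'rV[R]_q => expR ((t *m H) 0 k)) a =
  expR ((a *m H) 0 k) * (v *m H) 0 k.
Proof.
rewrite deriveE; last exact: differentiable_exp_predictor.
have dl := differentiable_mulmx_coord H k a.
rewrite (diff_comp dl (differentiable_expR _)) /=.
rewrite -(deriveE v dl) derive_mulmx_coord diff1E;
  last exact: differentiable_expR.
by rewrite derive1E derive_val mulrC.
Qed.

Lemma derive_logit_mx (a v : 'rV[R]_q) :
  'D_v (fun t : 'rV[R]_q => logit_mx L (t *m H)) a =
  row_mx (0 : 'M[R]_(K.+1, 1))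
    (- (den_mx R K L *m diag_mx (\row_j (expR ((a *m H) 0 j) * (v *m H) 0 j)))).
Proof.
rewrite derive_mx; last exact: derivable_logit_mx.
apply/matrixP => i j; rewrite mul_mx_diag [RHS]mxE mxE.
under eq_fun do rewrite logit_mxE.
case: (fintype.split _) => k; first by rewrite derive_cst mxE.
rewrite -[fun _ => _]/(cst _ - cst _ * (fun t => expR ((t *m H) 0 k))).
have de := diff_derivable (v := v) (differentiable_exp_predictor k a).
rewrite deriveB //; last by apply: derivableM.
rewrite deriveM // !derive_cst scaler0 addr0 sub0r derive_exp_predictor.
by rewrite !mxE.
Qed.

Lemma differentiable_logit_sol (a : 'rV[R]_q) :
  differentiable (fun t : 'rV[R]_q => logit_sol L (t *m H)) a.
Proof.
apply: differentiable_mx => i j; under eq_fun do rewrite mxE.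
apply: differentiable_bigsum => k _.
apply: (@differentiableM _ _ (cst _)); first exact: differentiable_cst.
apply: differentiable_invmx => [x|? ?]; first exact: logit_mx_unit.
exact: differentiable_logit_mx.
Qed.

(** Implicit differentiation: as pi A is constant, pi' A = - pi A'. The logit equations then replace
    each denominator times its exponential by the numerator. *)
Lemma derive_logit_sol (a v : 'rV[R]_q) (u := logit_sol L (a *m H)) :
  'D_v (fun t : 'rV[R]_q => logit_sol L (t *m H)) a *m logit_mx L (a *m H) =
  row_mx (0 : 'M[R]_1) (\row_j (logit_num L u j * (v *m H) 0 j)).
Proof.
have := derive_mulmx (diff_derivable (differentiable_logit_sol a))
  (@derivable_logit_mx a v).
have -> : (fun t : 'rV[R]_q => logit_sol L (t *m H) *m logit_mx L (t *m H)) =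
    cst (rhs_vec R K).
  by apply/funext => t; rewrite mulmxKV // logit_mx_unit.
rewrite derive_cst => /esym/eqP; rewrite addr_eq0 => /eqP ->.
have [_ uE] := (logit_solP L (a *m H) u).1 erefl.
rewrite derive_logit_mx -/u.
rewrite [u *m _](@mul_mx_row _ 1 K.+1 1 K) (@opp_row_mx _ 1 1 K).
rewrite mulmx0 oppr0 mulmxN opprK mulmxA mul_mx_diag.
apply: (congr1 (@row_mx R 1 1 K _)); apply/rowP => j.
by rewrite mxE mul_den_mx [X in _ * X]mxE [RHS]mxE mulrA -uE.
Qed.

End LogitDerivative.

(** * Jacobian and Fisher information at one setting *)

Section Fisher.
Variables (R : realType) (K d : nat) (p : 'I_K -> nat).
Variables (L : logit_type) (h : forall j, 'rV[R]_d -> 'cV[R]_(p j)).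
Implicit Types (theta : params R p) (x : 'rV[R]_d).

(** The linear solution is continuous in the parameter and positive at [theta], hence positive
    nearby, where it is the model probability. *)
Lemma npo_prob_near theta x pi : npo_model L h x theta pi ->
  \forall t \near theta, logit_sol L (t *m predictor_mx h x) = npo_prob L h x t.
Proof.
move=> /npo_modelP[pi0 piE].
have pos k : \forall t \near theta,
    0 < logit_sol L (t *m predictor_mx h x) 0 k.
  have /differentiable_continuous c : differentiable
      (fun t : params R p => logit_sol L (t *m predictor_mx h x) 0 k) theta.
    exact: (differentiable_comp
      (differentiable_logit_sol L (predictor_mx h x) theta)
      (differentiable_coord _ 0 k)).
  by apply: (cvgr_gt _ c); rewrite -piE.
apply: filterS (filter_forall (nbhs_filter theta) pos) => t t0.
by rewrite npo_probE.
Qed.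

Lemma jacobian_npo_prob theta x pi : npo_model L h x theta pi ->
  'J (npo_prob L h x) theta = predictor_mx h x *m
    (row_mx (0 : 'M[R]_(K, 1)) (diag_mx (\row_j logit_num L pi j)) *m
     invmx (logit_mx L (theta *m predictor_mx h x))).
Proof.
move=> mpi; have near_eq := npo_prob_near mpi.
have df := differentiable_logit_sol L (predictor_mx h x) theta.
have [_ piE] := (npo_modelP _ _ _ _ _).1 mpi.
(* Row [i] of the Jacobian is the derivative along the basis vector [i], which may be computed on
   the linear solution. *)
rewrite mulmxA; apply/row_matrixP => i; rewrite !rowE !mulmxA.
rewrite -deriveEjacobian; last exact: near_eq_differentiable near_eq df.
rewrite -(near_eq_derive _ near_eq).
set A := logit_mx _ _; have uA : A \in unitmx by exact: logit_mx_unit.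
apply: (canRL (mulmxK uA)); rewrite derive_logit_sol -piE.
rewrite [RHS](@mul_mx_row _ 1 K 1 K) mulmx0.
apply: (congr1 (@row_mx R 1 1 K _)); apply/rowP => j.
by rewrite mul_mx_diag !mxE mulrC.
Qed.

Lemma fisher_at_factor theta x pi : npo_model L h x theta pi ->
  exists2 U : 'M[R]_K, posdefmx U &
    fisher_at L h theta x = predictor_mx h x *m U *m (predictor_mx h x)^T.
Proof.
move=> mpi; have [pi0 piE] := (npo_modelP _ _ _ _ _).1 mpi.
rewrite /fisher_at (jacobian_npo_prob mpi).
have -> : npo_prob L h x theta = pi.
  by rewrite -(nbhs_singleton (npo_prob_near mpi)).
set S := row_mx _ _; set B := invmx (logit_mx _ _); set W := invmx _.
exists (S *m B *m W *m (S *m B)^T); last by rewrite trmx_mul !mulmxA.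
apply: posdefmx_congr.
  (* The inverse logit matrix cancels, and the remaining diagonal holds the positive logit
     numerators. *)
  apply: inj_row_free => v.
  rewrite mulmxA => /(canRL (mulmxKV (logit_mx_unit _ _))).
  rewrite mul0mx [LHS](@mul_mx_row _ 1 K 1 K) -[RHS](@row_mx0 _ 1 1 K).
  move=> /(@eq_row_mx R 1 1 K)[_ /rowP vS]; apply/rowP => j.
  have /eqP := vS j; rewrite mul_mx_diag !mxE mulf_eq0.
  by rewrite (gt_eqF (logit_num_gt0 L j pi0)) orbF => /eqP.
rewrite /W invmx_diag //; apply: posdefmx_diag => k.
by rewrite mxE invr_gt0.
Qed.

End Fisher.

Theorem corollaryS7 (R : realType) (K d : nat) (hK : (0 < K)%N)
    (p : 'I_K -> nat) (hp : forall j, (0 < p j)%N)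
    (L : logit_type) (h : forall j, 'rV[R]_d -> 'cV[R]_(p j))
    (X : set 'rV[R]_d) (theta : params R p)
    (htheta : forall x, X x -> exists pi, npo_model L h x theta pi)
    (n : nat) (hn : (0 < n)%N)
    (p1 : nat) (hp1 : forall j, p j = p1)
    (hrank : exists x : 'I_p1 -> 'rV[R]_d,
        distinct_settings X x /\ forall j, \rank (design_mx h x j) = p1) :
  minimal_number X n L h theta p1 /\
  forall x : 'I_p1 -> 'rV[R]_d, distinct_settings X x ->
    (exists w, allocation w /\ 0 < objective L h theta x w) ->
    D_optimal L h theta x (uniform_allocation p1).
Proof.
have sizeE : (\sum_(j < K) p j = p1 * K)%N.
  by under eq_bigr do rewrite hp1; rewrite sum_nat_const card_ord mulnC.
have p1_gt0 : (0 < p1)%N by rewrite -(hp1 (Ordinal hK)).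
have factor x : X x -> exists2 U : 'M[R]_K, posdefmx U &
    fisher_at L h theta x = predictor_mx h x *m U *m (predictor_mx h x)^T.
  by move=> /htheta[pi /fisher_at_factor].
(* Absorbing [U] and the transposed predictor matrix into [C] leaves the inner dimension [K] needed
   by the determinant and rank lemmas. *)
have mix m (x : 'I_m -> 'rV[R]_d) : distinct_settings X x ->
    exists C : 'I_m -> 'M[R]_(K, \sum_(j < K) p j), forall w,
    fisher_mix L h theta x w = \sum_i w i *: (predictor_mx h (x i) *m C i).
  move=> [_ Xx]; have /choice[U UE] i : exists U : 'M[R]_K,
      fisher_at L h theta (x i) =
      predictor_mx h (x i) *m U *m (predictor_mx h (x i))^T.
    by have [U _ UE] := factor _ (Xx i); exists U.
  exists (fun i => U i *m (predictor_mx h (x i))^T) => w.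
  by apply: eq_bigr => i _; rewrite UE mulmxA.
split; last first.
  move=> x dx [w [[w0 w1] obj_gt0]]; split; first exact: uniform_allocationP.
  have [C mixE] := mix _ _ dx.
  have [c detE] := det_sum_scale_mulmx (fun i => predictor_mx h (x i)) C sizeE.
  have objE w' : objective L h theta x w' = c * (\prod_i w' i) ^+ K.
    by rewrite /objective mixE detE.
  move=> w' alloc; rewrite !objE; rewrite objE in obj_gt0.
  (* The sign of [c] comes from the given allocation with positive objective: its product of weights
     is nonnegative. *)
  have c0 : 0 <= c.
    rewrite leNgt; apply/negP => c0; move: obj_gt0; apply/negP; rewrite -leNgt.
    by rewrite mulr_le0_ge0 ?(ltW c0) // exprn_ge0 // prodr_ge0.
  apply: ler_wpM2l => //; apply: lerXn2r; rewrite ?nnegrE.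
  - by apply: prodr_ge0 => i _; have [/(_ i)] := alloc.
  - by apply: prodr_ge0 => i _; rewrite invr_ge0 ler0n.
  - exact: prod_allocation_le.
split=> [|m [x [dx [w [_ /posdefmx_rank rankF]]]]]; last first.
  (* Positive definiteness gives rank [p1 * K], which is at most [m * K]; cancel [K]. *)
  have [C mixE] := mix _ _ dx.
  have := mxrank_sum_scale_mulmx (fun i => predictor_mx h (x i)) C w.
  rewrite -mixE; move: rankF.
  rewrite /fisher_information mxrank_scale_nz ?pnatr_eq0 -?lt0n // => ->.
  by rewrite sizeE leq_pmul2r.
have [x [dx rankx]] := hrank; exists x; split=> //.
exists (uniform_allocation p1); split; first exact: uniform_allocationP.
have Xx i : X (x i) by case: dx.
split=> [|v v0].
  rewrite /fisher_information /fisher_mix linearZ /= linear_sum /=.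
  congr (_ *: _); apply: eq_bigr => i _; rewrite linearZ /=.
  have [U [UT _] ->] := factor _ (Xx i).
  by rewrite !trmx_mul trmxK UT mulmxA.
(* Otherwise each block of [v] annihilates the corresponding design matrix, whose rows are
   independent, so [v] would be zero. *)
have [i vi0] : exists i, v *m predictor_mx h (x i) != 0.
  apply/existsP; apply: contraNT v0 => /existsPn vH.
  apply/eqP; rewrite -[v]submxrowK -[RHS](@submxrowK _ _ _ _ 0).
  apply: eq_mxrow => j; rewrite submxrow0.
  have free : row_free (design_mx h x j) by rewrite /row_free rankx hp1.
  apply: (row_free_inj free); rewrite mul0mx; apply/rowP => i.
  have /rowP/(_ j) := eqP (negPn (vH i)).
  rewrite mul_predictor_mx !mxE => vhj.
  rewrite -[RHS]vhj; apply: eq_bigr => a _; rewrite !mxE.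
  by rewrite mulrC.
rewrite /fisher_information -scalemxAr -scalemxAl mxE.
rewrite mulr_gt0 ?ltr0n // mulmx_sumr mulmx_suml summxE.
have term k : (v *m (uniform_allocation p1 k *: fisher_at L h theta (x k)) *m
    v^T) 0 0 = p1%:R^-1 * (v *m fisher_at L h theta (x k) *m v^T) 0 0.
  by rewrite -scalemxAr -scalemxAl mxE.
(* Every setting contributes a nonnegative term, and setting [i] a strictly positive one. *)
have quad k : (v *m predictor_mx h (x k) != 0 ->
    0 < (v *m fisher_at L h theta (x k) *m v^T) 0 0) /\
    0 <= (v *m fisher_at L h theta (x k) *m v^T) 0 0.
  have [U [_ Upos] ->] := factor _ (Xx k).
  have -> : v *m (predictor_mx h (x k) *m U *m (predictor_mx h (x k))^T)
        *m v^T =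
      (v *m predictor_mx h (x k)) *m U *m (v *m predictor_mx h (x k))^T.
    by rewrite trmx_mul !mulmxA.
  split=> [/Upos //|].
  have [->|/Upos/ltW //] := eqVneq (v *m predictor_mx h (x k)) 0.
  by rewrite !mul0mx mxE.
rewrite (bigD1 i) //= ltr_pwDl //.
  by rewrite term mulr_gt0 ?invr_gt0 ?ltr0n // (quad i).1.
by apply: sumr_ge0 => k _; rewrite term mulr_ge0 ?invr_ge0 ?ler0n // (quad k).2.
Qed.
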